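(* Let $k\ge1$ and $n_1,\ldots,n_k\ge 2$ be integers, and let $G=S_{n_1,\ldots,n_k}$ be the generalized star graph, with vertices $x_1,\ldots,x_m$ and $R=\mathbf{k}[x_1,\ldots,x_m]$. Then $\operatorname{reg}(R/NI(G))=a_G$.
   Context: $\mathbf{k}$ is a field, vertices are identified with variables, $R$ is standard graded. The path graph $P_t$ has vertices $1,\ldots,t$ and edges $\{1,2\},\ldots,\{t-1,t\}$. For integers $n_1,\ldots,n_k>1$, $S_{n_1,\ldots,n_k}$ is the graph obtained from the disjoint paths $P_{n_1},\ldots,P_{n_k}$ by identifying one end point of each path into a single common vertex. The closed neighborhood ideal is $NI(G)=\langle \prod_{x_j\in N[x_i]}x_j : x_i\in V(G)\rangle$ where $N[x_i]=\{x_i\}\cup\{x_j:\{x_i,x_j\}\in E(G)\}$. $a_G$ is the matching number of $G$. *)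

(* Defs.v *)
From HB Require Import structures.
From mathcomp Require Import all_boot all_order all_algebra.
Set Implicit Arguments. Unset Strict Implicit. Unset Printing Implicit Defensive.
Import Order.TTheory GRing.Theory Num.Theory.

(* Variables of R = K[x_v : v in V] are identified with the vertices.  *)
Section Graph.
Variables (V : finType) (e : rel V).

Definition closed_nbhd (v : V) : {set V} := v |: [set u | e v u].

Definition is_edge (E : {set V}) : bool :=
  [exists u, exists v, (u != v) && e u v && (E == [set u; v])].

Definition is_matching (M : {set {set V}}) : bool :=
  [forall E in M, is_edge E] &&
  [forall E in M, forall F in M, (E != F) ==> [disjoint E & F]].

Definition matching_number : nat :=
  \max_(M : {set {set V}} | is_matching M) #|M|.

(* Monomials x^b of R are exponent vectors b : V -> nat.
   NI(G) is generated by the squarefree monomials prod_{u in N[v]} x_u;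
   a monomial x^c lies in this monomial ideal iff it is divisible by one
   of the generators. *)
Definition in_NI (c : {ffun V -> nat}) : bool :=
  [exists v, [forall u in closed_nbhd v, 0 < c u]].

(* Multigraded Betti numbers of R/NI(G):                               *)
(*  beta_{i,b}(R/I) = dim_K Tor_i^R(R/I, K)_b, computed as the         *)
(*  homology of the Koszul complex K(x_v : v in V) (the minimal free   *)
(*  resolution of K) tensored with R/I, in multidegree b.              *)
(*  In multidegree b and homological degree i, K_i(x;R/I)_b has the    *)
(*  K-basis  e_F (x) x^(b - F)  for F a set of i variables with F      *)
(*  contained in supp b and x^(b-F) not in I.                          *)
Definition bminus (b : {ffun V -> nat}) (F : {set V}) : {ffun V -> nat} :=
  [ffun u => b u - (u \in F)].

Definition kchain (b : {ffun V -> nat}) (i : nat) : seq {set V} :=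
  [seq F : {set V} <- enum [set: {set V}] |
     [&& #|F| == i, [forall u in F, 0 < b u] & ~~ in_NI (bminus b F)]].

Variable K : fieldType.

(* coefficient of e_G in d(e_F): nonzero iff F = G + {j}, with the usual
   Koszul sign (-1)^(#{u in G | u < j}) for a fixed ordering of V. *)
Definition kcoef (F G : {set V}) : K :=
  if (G \subset F) && (#|F :\: G| == 1%N) then
    ((-1 : K) ^+ #|[set u in G | [exists j in F :\: G, (enum_rank u < enum_rank j)%N]]|)%R
  else 0%R.

(* matrix of d_i : K_i -> K_{i-1} in degree b (row-vector convention) *)
Definition kdiff (b : {ffun V -> nat}) (i : nat) :
  'M[K]_(size (kchain b i), size (kchain b i.-1)) :=
  \matrix_(p, q) kcoef (nth set0 (kchain b i) p) (nth set0 (kchain b i.-1) q).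

Definition krank (b : {ffun V -> nat}) (i : nat) : nat :=
  if i is 0 then 0 else \rank (kdiff b i).

(* dim_K H_i(K(x; R/I))_b = dim ker d_i - dim im d_{i+1} *)
Definition betti (i : nat) (b : {ffun V -> nat}) : nat :=
  (size (kchain b i) - krank b i - krank b i.+1)%N.

(* reg(R/NI(G)) = max { |b| - i : beta_{i,b}(R/NI(G)) <> 0 },
   where |b| = sum of the entries of b.  [is_reg r] says this max is r. *)
Definition is_reg (r : nat) : Prop :=
  (forall (i : nat) (b : {ffun V -> nat}),
      betti i b != 0%N -> (\sum_u b u <= i + r)%N) /\
  (exists (i : nat) (b : {ffun V -> nat}),
      betti i b != 0%N /\ (\sum_u b u)%N = (i + r)%N).

End Graph.

(* Vertex None is the common centre; vertex Some (i; p) is the vertex  *)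
(* of the i-th path P_{n_i} at distance p+1 from the centre,           *)
(* p < n_i - 1.                                                        *)
Definition star_vertex (k : nat) (n : 'I_k -> nat) : finType :=
  option {i : 'I_k & 'I_(n i).-1}.

Definition star_adj (k : nat) (n : 'I_k -> nat) : rel (star_vertex n) :=
  fun x y =>
    match x, y with
    | None, None => false
    | None, Some t => nat_of_ord (tagged t) == 0%N
    | Some t, None => nat_of_ord (tagged t) == 0%N
    | Some s, Some t =>
        (tag s == tag t) &&
        (((nat_of_ord (tagged s)).+1 == nat_of_ord (tagged t)) ||
         ((nat_of_ord (tagged t)).+1 == nat_of_ord (tagged s)))
    end.

Arguments star_adj {k} n x y : simpl never.
Arguments is_reg {V} e K r.
Arguments matching_number {V} e.

(* Main.v *)
Require Import Defs.
From HB Require Import structures.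
From mathcomp Require Import all_boot all_order all_algebra.
From mathcomp Require Import ring zify.
Set Implicit Arguments. Unset Strict Implicit. Unset Printing Implicit Defensive.
Import GRing.Theory.

(* In multidegree b the Koszul complex of R/NI(G) is a cone as soon as some
   exponent exceeds 1, and for b squarefree with support W it computes the
   homology of the Stanley-Reisner complex restricted to W.  The equality
   reg = matching number then holds for every forest, by induction.  Choose a
   deepest vertex w with a child, and a leaf l below w.  Colon by w turns NI(G)
   into (l) + NI(G - {w, l}), whose matching number is one less.  Deleting w
   removes the generators of w, of its leaves and of its parent, so for the
   upper bound one also allows a set of vertices without generator and proves
   reg <= matching number + number of such vertices.  For the lower bound, the
   deletion of w is a cone over l, hence the homology of the link of w survives
   one dimension higher, and the bound is attained in degree b = (1,...,1). *)

(** * Signed Koszul complexes on families of sets, split along one variable *)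

Section KoszulStrand.
Local Open Scope ring_scope.
Variables (V : finType) (K : fieldType).
Implicit Types (s : {set V} -> V -> K) (c : {set V} -> K) (W G F : {set V}).
Implicit Types (Q : pred {set V}) (x : V).

(** Abstract signs are used because the sets containing a given vertex again form such a complex,
    but with the signs [shift_sign]. Anticommutation is what gives boundary squared zero. *)
Definition koszul_sign s W :=
  (forall G j, s G j != 0) /\
  (forall G i j, G \subset W -> i \in W :\: G -> j \in W :\: G -> i != j ->
    s G i * s (i |: G) j = - (s G j * s (j |: G) i)).

Definition koszul_bd s W c G : K :=
  \sum_(j in W :\: G) s G j * c (j |: G).

(* For a family [Q] of subsets of [W] closed under supersets, the boundary at
   a member of [Q] only involves values of the chain on [Q]; this is why chains
   need no support condition. *)
Definition exact_at s W Q (i : nat) := forall c,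
  (forall G, G \subset W -> Q G -> #|G|.+1 = i -> koszul_bd s W c G = 0) ->
  exists c', forall G, G \subset W -> Q G -> #|G| = i ->
    koszul_bd s W c' G = c G.

Definition shift_sign s x G (j : V) : K := s (x |: G) j.

Lemma shift_koszul_sign s W x :
  x \in W -> koszul_sign s W -> koszul_sign (shift_sign s x) (W :\ x).
Proof.
move=> xW [s0 sA]; split=> [G j|G i j GW]; first exact: s0.
rewrite !inE => /and3P[iG ix iW] /and3P[jG jx jW] ij.
rewrite /shift_sign ![x |: (_ |: _)]setUCA; apply: sA => //.
- rewrite subUset sub1set xW; exact: subset_trans GW (subsetDl _ _).
- by rewrite !inE negb_or iG ix iW.
by rewrite !inE negb_or jG jx jW.
Qed.

Lemma koszul_signD1 s W x : koszul_sign s W -> koszul_sign s (W :\ x).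
Proof.
move=> [s0 sA]; split=> // G i j GW iW jW; apply: sA.
- exact: subset_trans GW (subsetDl _ _).
- by move: iW; apply/subsetP/setSD/subsetDl.
- by move: jW; apply/subsetP/setSD/subsetDl.
Qed.

Lemma koszul_bdD1 s W c G x : x \in W -> x \notin G ->
  koszul_bd s W c G = s G x * c (x |: G) + koszul_bd s (W :\ x) c G.
Proof.
move=> xW xG; rewrite /koszul_bd (bigD1 x) ?inE ?xG //=; congr (_ + _).
by apply: eq_bigl => j; rewrite !inE; case: (j == x); rewrite ?andbF ?andbT.
Qed.

Lemma koszul_bdU1 s W c G x :
  koszul_bd s W c (x |: G)
  = koszul_bd (shift_sign s x) (W :\ x) (fun F => c (x |: F)) G.
Proof.
apply: eq_big => [j|j _]; last by rewrite setUCA.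
by rewrite !inE negb_or; case: (j == x); rewrite ?andbF ?andbT.
Qed.

(** Scaling by [s F x] is the connecting map between the sets containing [x] and those avoiding it;
    it commutes with the boundaries up to sign. *)
Lemma koszul_bd_scale s W x c G : koszul_sign s W -> x \in W ->
  G \subset W :\ x ->
  koszul_bd s (W :\ x) (fun F => s F x * c F) G
  = - (s G x * koszul_bd (shift_sign s x) (W :\ x) c G).
Proof.
move=> [s0 sA] xW GW; rewrite /koszul_bd mulr_sumr -sumrN.
apply: eq_bigr => j; rewrite !inE => /and3P[jG jx jW].
rewrite !mulrA sA ?mulNr // ?inE ?jG ?xW //.
- exact: subset_trans GW (subsetDl _ _).
- by rewrite andbT; apply/negP => /(subsetP GW); rewrite !inE eqxx.
Qed.

Lemma koszul_bdB s W c1 c2 G :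
  koszul_bd s W (fun F => c1 F - c2 F) G = koszul_bd s W c1 G - koszul_bd s W c2 G.
Proof. by rewrite /koszul_bd -sumrB; apply: eq_bigr => j _; rewrite mulrBr. Qed.

Lemma eq_koszul_bd s W c1 c2 G :
  (forall j, j \in W :\: G -> c1 (j |: G) = c2 (j |: G)) ->
  koszul_bd s W c1 G = koszul_bd s W c2 G.
Proof. by move=> E; apply: eq_bigr => j jW; rewrite E. Qed.

Lemma eq_exact_at s W Q Q' i :
  (forall G, G \subset W -> Q G = Q' G) -> exact_at s W Q i -> exact_at s W Q' i.
Proof.
move=> E H c cyc; have [|c' c'P] := H c.
  by move=> G GW; rewrite E //; apply: cyc.
by exists c' => G GW; rewrite -E //; apply: c'P.
Qed.

Section Split.
Variables (s : {set V} -> V -> K) (W : {set V}) (Q : pred {set V}) (x : V).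
Hypotheses (sP : koszul_sign s W) (xW : x \in W).
Hypothesis QU1 : forall G, G \subset W :\ x -> Q G -> Q (x |: G).

Let Q1 : pred {set V} := fun G => Q (x |: G).

Lemma subsetD1_notin G : G \subset W :\ x -> x \notin G.
Proof. by move=> GW; apply/negP => /(subsetP GW); rewrite !inE eqxx. Qed.

Lemma subsetU1_D1 G : G \subset W :\ x -> x |: G \subset W.
Proof.
by move=> GW; rewrite subUset sub1set xW (subset_trans GW (subsetDl _ _)).
Qed.

Lemma setU1_split G : G \subset W ->
  G \subset W :\ x \/ exists2 F : {set V}, F \subset W :\ x & G = x |: F.
Proof.
move=> GW; have [xG|xG] := boolP (x \in G); last by left; rewrite subsetD1 GW.
by right; exists (G :\ x); [apply: setSD | rewrite setD1K].
Qed.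

(** Chains on sets avoiding [x] form a subcomplex, and the quotient is the complex of [Q1] with
    degree lowered by one. This is the middle term of the long exact sequence. *)
Lemma exact_at_split i :
  (forall i', i = i'.+1 -> exact_at (shift_sign s x) (W :\ x) Q1 i') ->
  exact_at s (W :\ x) Q i -> exact_at s W Q i.
Proof.
move=> H1 H0 c cyc.
have [c1 c1P] : exists c1, forall G, G \subset W :\ x -> Q1 G -> #|G|.+1 = i ->
    koszul_bd (shift_sign s x) (W :\ x) c1 G = c (x |: G).
  case: i H1 {H0} cyc => [|i] H1 cyc; first by exists (fun=> 0).
  have [|c1 c1P] := H1 i erefl (fun G => c (x |: G)).
    move=> G GW QG Gi; rewrite -koszul_bdU1; apply: cyc => //.
      exact: subsetU1_D1.
    by rewrite cardsU1 (subsetD1_notin GW) add1n Gi.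
  by exists c1 => G GW QG [Gi]; apply: c1P.
(* Placing [c1] on the sets containing [x] already contributes [s F x * c1 F] at [F]; the remainder
   is a cycle of the subcomplex. *)
have [|c0 c0P] := H0 (fun F => c F - s F x * c1 F).
  move=> G GW QG Gi.
  rewrite koszul_bdB koszul_bd_scale // c1P ?QU1 //; last exact: QU1.
  have := cyc G (subset_trans GW (subsetDl _ _)) QG Gi.
  rewrite (koszul_bdD1 _ _ xW (subsetD1_notin GW)) => <-; ring.
exists (fun F => if x \in F then c1 (F :\ x) else c0 F) => G GW QG Gi.
have [{}GW|[F FW defG]] := setU1_split GW.
  have xG := subsetD1_notin GW.
  rewrite (koszul_bdD1 _ _ xW xG) setU11 setU1K //.
  rewrite (@eq_koszul_bd _ _ _ c0); last first.
    by move=> j; rewrite !inE => /and3P[_ /negPf jx _]; rewrite eq_sym jx (negPf xG).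
  by rewrite c0P //; ring.
have xF := subsetD1_notin FW.
rewrite defG in QG Gi *; rewrite koszul_bdU1 -c1P //; last first.
  by rewrite -Gi cardsU1 xF.
apply: eq_koszul_bd => j; rewrite !inE eqxx => /and3P[jF jx jW] /=.
by rewrite setU1K // !inE negb_or eq_sym jx.
Qed.

(** Another stretch of the same long exact sequence: homology of the subcomplex vanishes between
    vanishing homology of the quotient and of the whole. *)
Lemma exact_at_link i : exact_at (shift_sign s x) (W :\ x) Q1 i ->
  exact_at s W Q i -> exact_at s (W :\ x) Q i.
Proof.
move=> H1 H c cyc.
have [|c' c'P] := H (fun G => if x \in G then 0 else c G).
  move=> G GW QG Gi; have [{}GW|[F FW ->]] := setU1_split GW; last first.
    rewrite koszul_bdU1; apply: big1 => j _.
    by rewrite !inE eqxx mulr0.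
  have xG := subsetD1_notin GW.
  rewrite (koszul_bdD1 _ _ xW xG) setU11 mulr0 add0r -(cyc G) //.
  apply: eq_koszul_bd => j; rewrite !inE => /and3P[_ jx _].
  by rewrite eq_sym (negPf jx) (negPf xG).
(* The part of [c'] on sets containing [x] is a cycle of the quotient. Its primitive [g], scaled by
   the connecting sign, corrects [c'] into a primitive inside the subcomplex. *)
have [|g gP] := H1 (fun F => c' (x |: F)).
  move=> G GW QG Gi; rewrite -koszul_bdU1 c'P ?setU11 ?subsetU1_D1 //.
  by rewrite cardsU1 (subsetD1_notin GW).
exists (fun F => c' F - s F x * g F) => G GW QG Gi.
have xG := subsetD1_notin GW.
rewrite koszul_bdB koszul_bd_scale // gP //; last exact: QU1.
have := c'P G (subset_trans GW (subsetDl _ _)) QG Gi.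
by rewrite (negPf xG) (koszul_bdD1 _ _ xW xG) => <-; ring.
Qed.

(** When membership in [Q] does not depend on [x], inserting [x] is a contracting homotopy, up to
    the invertible sign. *)
Lemma exact_at_cone i :
  (forall G, G \subset W :\ x -> Q (x |: G) -> Q G) -> exact_at s W Q i.
Proof.
move=> QD1 c cyc; have [s0 sA] := sP.
exists (fun F => if x \in F then (s (F :\ x) x)^-1 * c (F :\ x) else 0).
move=> G GW QG Gi; have [{}GW|[F FW defG]] := setU1_split GW.
  have xG := subsetD1_notin GW.
  rewrite (koszul_bdD1 _ _ xW xG) setU11 setU1K // mulrA divff // mul1r.
  rewrite /koszul_bd big1 ?addr0 // => j; rewrite !inE => /and3P[_ jx _].
  by rewrite eq_sym (negPf jx) (negPf xG) mulr0.
have xF := subsetD1_notin FW; rewrite defG in QG Gi *.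
have QF := QD1 F FW QG.
have Fi : #|F|.+1 = i by rewrite -Gi cardsU1 xF.
have := cyc F (subset_trans FW (subsetDl _ _)) QF Fi.
rewrite (koszul_bdD1 _ _ xW xF) koszul_bdU1.
rewrite (@eq_koszul_bd (shift_sign s x) _ _ (fun F => (s F x)^-1 * c F)); last first.
  move=> j; rewrite !inE eqxx => /and3P[jF jx jW] /=.
  by rewrite setU1K // !inE negb_or eq_sym jx.
rewrite -(@eq_koszul_bd s _ (fun F => s F x * ((s F x)^-1 * c F))); last first.
  by move=> j _; rewrite mulrA divff // mul1r.
rewrite koszul_bd_scale // -mulrN -mulrDr => /eqP.
by rewrite mulf_eq0 (negPf (s0 _ _)) subr_eq0 => /eqP ->.
Qed.

End Split.
End KoszulStrand.

(** * Vanishing of Betti numbers as exactness of the Koszul strand *)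

Section BettiExactness.
Local Open Scope ring_scope.
Variables (V : finType) (e : rel V) (K : fieldType).
Implicit Types (W G F : {set V}) (b : {ffun V -> nat}) (c : {set V} -> K).

Definition rank_sign G (j : V) : K :=
  (-1) ^+ #|[set u in G | (enum_rank u < enum_rank j)%N]|.

Lemma rank_signU1 G i j : i \notin G ->
  rank_sign (i |: G) j = (-1) ^+ (enum_rank i < enum_rank j)%N * rank_sign G j.
Proof.
move=> iG; rewrite /rank_sign -exprD; congr (_ ^+ _).
have [ij|ij] := boolP (enum_rank i < enum_rank j)%N.
  rewrite (_ : [set u in i |: G | _] =
    i |: [set u in G | (enum_rank u < enum_rank j)%N]).
    by rewrite cardsU1 !inE (negPf iG).
  by apply/setP => u; rewrite !inE; case: eqP => // ->; rewrite ij.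
rewrite add0n; apply: eq_card => u.
by rewrite !inE; case: eqP => // ->; rewrite (negPf ij) !andbF.
Qed.

Lemma koszul_rank_sign W : koszul_sign rank_sign W.
Proof.
split=> [G j|G i j _]; first by rewrite signr_eq0.
rewrite !inE => /andP[iG _] /andP[jG _] ij; rewrite !rank_signU1 //.
case: ltngtP => [||/val_inj/enum_rank_inj /eqP]; rewrite ?(negPf ij) //=;
  rewrite ?expr0 ?expr1 => _; ring.
Qed.

(** The pairs are split by [enum_rank] and swapped: that the sum equals its own opposite would prove
    nothing in characteristic two. *)
Lemma sum_antisym (I : finType) (P : pred I) (T : I -> I -> K) :
  (forall i j, P i -> P j -> i != j -> T i j = - T j i) ->
  \sum_(i | P i) \sum_(j | P j && (j != i)) T i j = 0.
Proof.
move=> TA; rewrite pair_big_dep /=.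
rewrite (bigID (fun p : I * I => (enum_rank p.1 < enum_rank p.2)%N)) /=.
rewrite [X in _ + X](reindex (fun p : I * I => (p.2, p.1))) /=; last first.
  by exists (fun p : I * I => (p.2, p.1)) => -[].
apply/eqP; rewrite addr_eq0 -sumrN; apply/eqP; apply: eq_big => [[i j]|[i j]] /=.
  rewrite (eq_sym i j) -!andbA; do 2!case: (P _) => //=.
  by case: ltngtP => [||/val_inj/enum_rank_inj ->]; rewrite ?eqxx ?andbT ?andbF.
by case/andP=> /and3P[Pi Pj ji] _; rewrite TA // eq_sym.
Qed.

Lemma koszul_bd_bd (s : {set V} -> V -> K) W c G : koszul_sign s W ->
  G \subset W -> koszul_bd s W (koszul_bd s W c) G = 0.
Proof.
move=> [_ sA] GW; rewrite /koszul_bd.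
rewrite -[RHS](@sum_antisym V (mem (W :\: G))
  (fun i j => s G i * (s (i |: G) j * c (j |: (i |: G))))); last first.
  by move=> i j iW jW ij; rewrite !mulrA sA // mulNr setUCA.
apply: eq_bigr => i _; rewrite mulr_sumr; apply: eq_bigl => j.
by rewrite !inE negb_or; case: (j == i); rewrite ?andbF ?andbT.
Qed.

Definition bsupp b : {set V} := [set u | 0 < b u]%N.
Definition strand b : pred {set V} := fun F => ~~ in_NI e (bminus b F).

Lemma mem_kchain b i F :
  (F \in kchain e b i) = [&& #|F| == i, F \subset bsupp b & strand b F].
Proof.
rewrite mem_filter mem_enum in_setT andbT; congr [&& _, _ & _].
by apply/forall_inP/subsetP => H u /H; rewrite inE.
Qed.

Lemma kchain_uniq b i : uniq (kchain e b i).
Proof. exact: filter_uniq (enum_uniq _). Qed.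

Lemma strandU1 b G j : strand b G -> strand b (j |: G).
Proof.
apply: contra => /existsP[v /forall_inP H].
apply/existsP; exists v; apply/forall_inP => u /H; rewrite !ffunE !inE; lia.
Qed.

Lemma kcoefU1 G j : j \notin G -> kcoef K (j |: G) G = rank_sign G j.
Proof.
move=> jG; rewrite /kcoef subsetUr.
have -> : (j |: G) :\: G = [set j].
  by apply/setP => u; rewrite !inE; case: eqP => [->|_]; rewrite ?jG //= andNb.
rewrite cards1 /=; congr (_ ^+ _); apply: eq_card => u.
rewrite !inE; congr (_ && _); apply/exists_inP/idP => [[i]|ij].
  by rewrite inE => /eqP ->.
by exists j; rewrite ?inE.
Qed.

(** Only the sets [j |: G] have a nonzero coefficient, and all of them with [j] in [bsupp b] are
    basis elements, since the strand is closed under supersets. *)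
Lemma sum_kcoef b i c G : G \in kchain e b i ->
  \sum_(F <- kchain e b i.+1) c F * kcoef K F G = koszul_bd rank_sign (bsupp b) c G.
Proof.
rewrite mem_kchain => /and3P[/eqP Gi Gb Gs].
rewrite big_uniq ?kchain_uniq //= (bigID (fun F => G \subset F)) /=.
rewrite [X in _ + X]big1 ?addr0; last first.
  by move=> F /andP[_ /negPf nGF]; rewrite /kcoef nGF mulr0.
rewrite (eq_bigl (mem [set j |: G | j in bsupp b :\: G])); last first.
  move=> F /=; rewrite mem_kchain; apply/andP/imsetP => [[/and3P[/eqP Fi Fb _]] GF|].
    have /eqP/cards1P[j Ej] : #|F :\: G| = 1%N.
      by rewrite cardsD (setIidPr GF) Fi Gi; lia.
    have : j \in F :\: G by rewrite Ej inE.
    rewrite inE => /andP[jG jF]; exists j; first by rewrite inE jG (subsetP Fb).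
    by rewrite -Ej setUC -[LHS](setID _ G) (setIidPr GF).
  case=> j; rewrite inE => /andP[jG jb] ->.
  by rewrite cardsU1 jG Gi eqxx subUset sub1set jb Gb strandU1 // subsetUr.
rewrite big_imset /=; last first.
  move=> j k; rewrite !inE => /andP[jG _] /andP[kG _] /setP/(_ j).
  by rewrite !inE eqxx (negPf jG) !orbF => /esym/eqP.
by apply: eq_bigr => j; rewrite inE => /andP[jG _]; rewrite kcoefU1 // mulrC.
Qed.

Definition chain_row b i c : 'rV[K]_(size (kchain e b i)) :=
  \row_p c (nth set0 (kchain e b i) p).

Lemma chain_row_surj b i (v : 'rV[K]_(size (kchain e b i))) :
  exists c, v = chain_row b i c.
Proof.
exists (fun F => if insub (index F (kchain e b i)) is Some p then v 0 p else 0).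
apply/rowP => p; rewrite mxE index_uniq ?kchain_uniq //.
by rewrite valK.
Qed.

Lemma mul_chain_row b i c :
  chain_row b i.+1 c *m kdiff e K b i.+1
  = chain_row b i (koszul_bd rank_sign (bsupp b) c).
Proof.
apply/rowP => q; rewrite mxE mxE.
rewrite -(@sum_kcoef _ i); last exact: mem_nth.
rewrite (big_nth set0) big_mkord; apply: eq_bigr => p _.
by rewrite !mxE.
Qed.

Lemma eq_chain_row b i c c' :
  chain_row b i c = chain_row b i c' <->
  (forall G, G \subset bsupp b -> strand b G -> #|G| = i -> c G = c' G).
Proof.
split=> [E G Gb Gs Gi|E].
  have Gk : G \in kchain e b i by rewrite mem_kchain Gi eqxx Gb.
  have Gp : (index G (kchain e b i) < size (kchain e b i))%N by rewrite index_mem.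
  by have /rowP/(_ (Ordinal Gp)) := E; rewrite !mxE /= nth_index.
apply/rowP => p; rewrite !mxE.
have := mem_nth set0 (ltn_ord p); rewrite mem_kchain => /and3P[/eqP Gi Gb Gs].
exact: E.
Qed.

Lemma chain_row0 b i : chain_row b i (fun=> 0) = 0.
Proof. by apply/rowP => p; rewrite !mxE. Qed.

(** A zero truncated difference only says that the rank of the incoming differential is at least the
    nullity of the outgoing one; as [bd2] puts the image inside the kernel, the two then
    coincide. *)
Lemma betti_exact b i :
  betti e K i b = 0%N <-> exact_at rank_sign (bsupp b) (strand b) i.
Proof.
have bd2 j : kdiff e K b j.+2 *m kdiff e K b j.+1 = 0.
  apply/row_matrixP => p; rewrite row_mul row0.
  rewrite rowE; have [c ->] := chain_row_surj (delta_mx 0 p).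
  rewrite !mul_chain_row -(chain_row0 b j); apply/eq_chain_row => G Gb _ _.
  exact: koszul_bd_bd (koszul_rank_sign _) _.
have cycP j c : (forall G, G \subset bsupp b -> strand b G -> #|G|.+1 = j.+1 ->
      koszul_bd rank_sign (bsupp b) c G = 0) <->
    (chain_row b j.+1 c <= kermx (kdiff e K b j.+1))%MS.
  split=> [cyc|/sub_kermxP].
    apply/sub_kermxP; rewrite mul_chain_row -(chain_row0 b j).
    by apply/eq_chain_row => G Gb Gs Gj; apply: cyc; rewrite ?Gj.
  rewrite mul_chain_row -(chain_row0 b j) => /eq_chain_row H G Gb Gs [Gj].
  exact: H.
have bdP c : (exists c', forall G, G \subset bsupp b -> strand b G -> #|G| = i ->
      koszul_bd rank_sign (bsupp b) c' G = c G) <->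
    (chain_row b i c <= kdiff e K b i.+1)%MS.
  split=> [[c' /eq_chain_row E]|/submxP[v]].
    by rewrite -E -mul_chain_row submxMl.
  have [c' ->] := chain_row_surj v; rewrite mul_chain_row => /esym/eq_chain_row E.
  by exists c'.
rewrite /betti; case: i bdP => [|i] bdP; rewrite /krank -/(krank _ _ _ _).
  (* In degree 0 every chain is a cycle, so exactness means that the incoming matrix has full column
     rank. *)
  rewrite subn0; split=> [/eqP|H].
    rewrite subn_eq0 => rk c _; apply/bdP/submx_full.
    by rewrite /row_full eqn_leq rank_leq_col.
  apply/eqP; rewrite subn_eq0 -[X in (X <= _)%N](mxrank1 K); apply: mxrankS.
  apply/row_subP => p; have [c ->] := chain_row_surj (row p 1%:M).
  by apply/bdP/H.
split=> [/eqP|H].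
  rewrite subn_eq0 -mxrank_ker => rk c /cycP cyc; apply/bdP.
  have sub : (kdiff e K b i.+2 <= kermx (kdiff e K b i.+1))%MS.
    by apply/sub_kermxP.
  by rewrite (geq_leqif (mxrank_leqif_sup sub)) in rk; apply: submx_trans cyc rk.
apply/eqP; rewrite subn_eq0 -mxrank_ker; apply: mxrankS; apply/row_subP => p.
have [c Ec] := chain_row_surj (row p (kermx (kdiff e K b i.+1))).
by rewrite Ec; apply/bdP/H/cycP; rewrite -Ec row_sub.
Qed.

End BettiExactness.

(** * Regularity bounds through links and deletions *)

Section Vanishing.
Variables (V : finType) (K : fieldType).
Implicit Types (N : pred {set V}) (C W S T F G : {set V}) (x : V).

(* [N] is the set of squarefree monomials of an ideal; a Koszul generator [F]
   in the squarefree degree [W] is the complement of the face [W :\: F] of the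
   Stanley-Reisner complex. *)
Definition coface N W : pred {set V} := fun F => ~~ N (W :\: F).
Definition up_closed N := forall S T, S \subset T -> N S -> N T.
Definition colon N x : pred {set V} := fun S => N (x |: S).

(** Nonzero homology in squarefree degree [W] and homological degree [i] forces [#|W| - i < r]. All
    signs and all [W] inside [C] are included so that the bound passes to links and deletions. *)
Definition reg_lt N C (r : nat) := forall W (s : {set V} -> V -> K) i,
  W \subset C -> koszul_sign s W -> i + r <= #|W| -> exact_at s W (coface N W) i.

Lemma coface_deletion N W x G : coface N W (x |: G) = coface N (W :\ x) G.
Proof. by rewrite /coface setDDl. Qed.

Lemma coface_link N W x G : x \in W -> x \notin G ->
  coface N W G = coface (colon N x) (W :\ x) G.
Proof.
move=> xW xG; rewrite /coface /colon; congr (~~ N _); apply/setP => u.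
by rewrite !inE; case: eqP => // ->; rewrite xW xG.
Qed.

Lemma coface_up N W F G : up_closed N -> F \subset G -> coface N W F -> coface N W G.
Proof. by move=> upN FG; apply/contra/upN/setDS. Qed.

Lemma exact_coface_split N W x (s : {set V} -> V -> K) i :
  up_closed N -> koszul_sign s W -> x \in W ->
  (forall i', i = i'.+1 ->
    exact_at (shift_sign s x) (W :\ x) (coface N (W :\ x)) i') ->
  exact_at s (W :\ x) (coface (colon N x) (W :\ x)) i ->
  exact_at s W (coface N W) i.
Proof.
move=> upN sP xW Hdel Hlink; apply: (exact_at_split sP xW).
- by move=> G _; apply: coface_up upN _; apply: subsetUr.
- move=> i' /Hdel; apply: eq_exact_at => G _; by rewrite coface_deletion.
apply: eq_exact_at Hlink => G GW; rewrite -coface_link //.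
exact: subsetD1_notin GW.
Qed.

Lemma reg_lt_leq N C r r' : r <= r' -> reg_lt N C r -> reg_lt N C r'.
Proof.
by move=> rr' H W s i WC sP iW; apply: H => //; apply: leq_trans iW; rewrite leq_add2l.
Qed.

Lemma eq_reg_lt N N' C r : (forall S, S \subset C -> N S = N' S) ->
  reg_lt N C r -> reg_lt N' C r.
Proof.
move=> E H W s i WC sP iW; apply: eq_exact_at (H W s i WC sP iW) => G _.
by rewrite /coface E // (subset_trans (subsetDl _ _)).
Qed.

(** The deletion lowers both [#|W|] and [i] and so keeps the bound [r.+1], whereas the link lowers
    only [#|W|] and needs [r]. *)
Lemma reg_lt_split N C x r : up_closed N ->
  reg_lt (colon N x) (C :\ x) r -> reg_lt N (C :\ x) r.+1 -> reg_lt N C r.+1.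
Proof.
move=> upN Hlink Hdel W s i WC sP iW.
have [xW|xW] := boolP (x \in W); last by apply: Hdel => //; rewrite subsetD1 WC.
have WxC : W :\ x \subset C :\ x by apply: setSD.
move: iW; rewrite (cardsD1 x W) xW => iW.
apply: (exact_coface_split upN sP xW) => [i' Ei|].
  by apply: Hdel => //; [apply: shift_koszul_sign | lia].
by apply: Hlink => //; [apply: koszul_signD1 | lia].
Qed.

Lemma reg_lt_var N C x r : up_closed N -> (forall S, N (x |: S)) ->
  reg_lt N (C :\ x) r -> reg_lt N C r.
Proof.
move=> upN Nx Hdel W s i WC sP iW.
have [xW|xW] := boolP (x \in W); last by apply: Hdel => //; rewrite subsetD1 WC.
move: iW; rewrite (cardsD1 x W) xW => iW.
apply: (exact_coface_split upN sP xW) => [i' Ei|].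
  by apply: Hdel; [apply: setSD | apply: shift_koszul_sign | lia].
(* The colon by [x] is the unit ideal, so its family of cofaces is empty. *)
by move=> c _; exists c => G _; rewrite /coface /colon Nx.
Qed.

(** A variable dividing no minimal generator makes the complex a cone. *)
Lemma reg_lt_free N C x r :
  (forall S, S \subset C :\ x -> N (x |: S) -> N S) ->
  reg_lt N (C :\ x) r -> reg_lt N C r.
Proof.
move=> Nx Hdel W s i WC sP iW.
have [xW|xW] := boolP (x \in W); last by apply: Hdel => //; rewrite subsetD1 WC.
apply: (exact_at_cone sP xW) => G GW.
rewrite coface_deletion (coface_link _ xW (subsetD1_notin GW)).
apply/contra/Nx; exact: subset_trans (subsetDl _ _) (setSD _ WC).
Qed.

End Vanishing.

(** * Matching numbers of induced subgraphs under deletion of a vertex *)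

Section Matching.
Variables (V : finType) (e : rel V).
Hypotheses (e_sym : symmetric e) (eirr : irreflexive e).
Implicit Types (C : {set V}).

Definition matching_in C (M : {set {set V}}) :=
  is_matching e M && [forall E in M, E \subset C].

Definition nu C : nat := \max_(M | matching_in C M) #|M|.

Lemma nu_setT : nu setT = matching_number e.
Proof.
apply: eq_bigl => M; rewrite /matching_in (_ : [forall E in M, _]) ?andbT //.
by apply/forall_inP => E _; apply: subsetT.
Qed.

Lemma nu_ex C : exists2 M, matching_in C M & #|M| = nu C.
Proof.
have M0 : matching_in C set0.
  by rewrite /matching_in -!andbA; apply/and3P; split; apply/forall_inP => E; rewrite inE.
have [|M MC EM] := @eq_bigmax_cond _ [pred M | matching_in C M] (fun M => #|M|).
  by apply/card_gt0P; exists set0.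
by exists M; rewrite -?EM.
Qed.

Lemma leq_nu C M : matching_in C M -> #|M| <= nu C.
Proof. by move=> MC; apply: (@leq_bigmax_cond _ _ (fun M : {set {set V}} => #|M|)). Qed.

Lemma matching_inP C (M : {set {set V}}) :
  reflect [/\ forall E, E \in M -> exists u v, [/\ u != v, e u v & E = [set u; v]],
              forall E F, E \in M -> F \in M -> E != F -> [disjoint E & F] &
              forall E, E \in M -> E \subset C] (matching_in C M).
Proof.
apply: (iffP idP) => [/andP[/andP[/forall_inP H1 /forall_inP H2] /forall_inP H3]|].
  split=> // [E /H1|E F /H2 /forall_inP H /H]; last by move/implyP.
  by case/existsP=> u /existsP[v /andP[/andP[uv euv] /eqP ->]]; exists u, v.
case=> H1 H2 H3; rewrite /matching_in /is_matching -andbA; apply/and3P; split.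
- apply/forall_inP => E /H1[u [v [uv euv ->]]].
  by apply/existsP; exists u; apply/existsP; exists v; rewrite uv euv eqxx.
- apply/forall_inP => E EM; apply/forall_inP => F FM; apply/implyP; exact: H2.
by apply/forall_inP.
Qed.

Lemma nuS C C' : C \subset C' -> nu C <= nu C'.
Proof.
move=> CC'; have [M /matching_inP[H1 H2 H3] <-] := nu_ex C.
by apply/leq_nu/matching_inP; split=> // E /H3 /subset_trans; apply.
Qed.

(** At most one edge of a matching contains [w]. *)
Lemma nu_leD1 C w : nu C <= (nu (C :\ w)).+1.
Proof.
have [M /matching_inP[H1 H2 H3] <-] := nu_ex C.
have H : #|[set E in M | w \notin E]| <= nu (C :\ w).
  apply/leq_nu/matching_inP; split=> [E|E F|E]; rewrite !inE => /andP[EM wE].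
  - exact: H1.
  - by move=> /andP[FM _]; apply: H2.
  - by rewrite subsetD1 wE H3.
apply: leq_trans (leq_add (leqnn 1) H); rewrite add1n.
rewrite -(cardsID [set E : {set V} | w \in E] M) -add1n; apply: leq_add; last first.
  by apply: eq_leq; apply: eq_card => E; rewrite !inE andbC.
apply/card_le1_eqP => E F; rewrite !inE => /andP[EM wE] /andP[FM wF].
apply/eqP/negPn/negP => nEF; have := H2 _ _ EM FM; rewrite eq_sym => /(_ nEF).
by move/disjointFr/(_ wE); rewrite wF.
Qed.

(** Without [w] the leaf [l] is isolated, so the edge from [w] to [l] can be added to any matching
    of [C :\ w]. *)
Lemma nu_geD1 C w l : w \in C -> l \in C -> e w l ->
  (forall u, u \in C -> e l u -> u = w) -> nu (C :\ w) < nu C.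
Proof.
move=> wC lC ewl leaf; have [M /matching_inP[H1 H2 H3] <-] := nu_ex (C :\ w).
have wl : w != l by apply: contraTneq ewl => ->; rewrite eirr.
have disj E : E \in M -> [disjoint [set w; l] & E].
  move=> EM; rewrite disjoint_subset; apply/subsetP => u.
  rewrite !inE => /orP[] /eqP ->; apply/negP => uE; have := subsetP (H3 _ EM) _ uE.
    by rewrite !inE eqxx.
  have [a [b [ab eab E_ab]]] := H1 _ EM.
  have inC z : z \in E -> z != w /\ z \in C.
    by move/(subsetP (H3 _ EM)); rewrite !inE => /andP[].
  have [aw aC] := inC a ltac:(by rewrite E_ab !inE eqxx).
  have [bw bC] := inC b ltac:(by rewrite E_ab !inE eqxx orbT).
  move: uE; rewrite E_ab !inE => /orP[] /eqP El; subst l.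
    by rewrite (leaf b bC eab) eqxx in bw.
  by rewrite (leaf a aC) ?eqxx in aw; rewrite // e_sym.
have nM : [set w; l] \notin M.
  apply/negP => /disj/disjointFr/(_ (set21 w l)); by rewrite set21.
have := @leq_nu C ([set w; l] |: M); rewrite cardsU1 nM; apply.
apply/matching_inP; split=> [E|E F|E].
- by case/setU1P=> [->|/H1//]; exists w, l.
- case/setU1P=> [->|EM] /setU1P[->|FM] nEF; first by rewrite eqxx in nEF.
  + exact: disj.
  + by rewrite disjoint_sym disj.
  + exact: H2.
case/setU1P=> [->|/H3]; last by rewrite subsetD1 => /andP[].
by apply/subsetP => u; rewrite !inE => /orP[] /eqP ->.
Qed.

End Matching.

(** * Regularity of closed neighborhood ideals of forests *)

Section Forest.
Variables (V : finType) (e : rel V) (K : fieldType) (dep : V -> nat).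
Hypothesis e_sym : symmetric e.
(* The existence of such a depth function characterises forests. *)
Hypothesis dep_neq : forall u v, e u v -> dep u != dep v.
Hypothesis parent_uniq : forall v u u',
  e v u -> e v u' -> dep u < dep v -> dep u' < dep v -> u = u'.
Implicit Types (A B C S : {set V}) (u v w x l : V).

Lemma forest_irr : irreflexive e.
Proof. by move=> u; apply/negP => /dep_neq; rewrite eqxx. Qed.

Definition has_nbr C v := [exists u in C, e v u].

Lemma forest_leaf C : [exists u in C, has_nbr C u] -> exists w l,
  [/\ w \in C, l \in C, e w l, forall u, u \in C -> e l u -> u = w &
      forall u v, e w u -> e w v -> u \in C -> v \in C ->
        has_nbr (C :\ w) u -> has_nbr (C :\ w) v -> u = v].
Proof.
pose P w := (w \in C) && [exists l in C, e w l && (dep w < dep l)].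
move=> /exists_inP[u uC /exists_inP[v vC euv]].
have [w0 Pw0] : exists w0, P w0.
  have := dep_neq euv; rewrite neq_ltn => /orP[uv|vu]; [exists u | exists v];
    apply/andP; split=> //; apply/exists_inP.
  - by exists v; rewrite ?euv.
  - by exists u; rewrite // e_sym euv.
case: (arg_maxnP dep Pw0) => w /andP[wC /exists_inP[l lC /andP[ewl wl]]] wmax.
have leaf a : e w a -> dep w < dep a -> a \in C -> forall z, z \in C -> e a z -> z = w.
  move=> ewa wa aC z zC eaz; have := dep_neq eaz; rewrite neq_ltn => /orP[az|za].
    have /wmax : P a by apply/andP; split=> //; apply/exists_inP; exists z; rewrite ?eaz.
    by rewrite /= leqNgt wa.
  by apply: (@parent_uniq a); rewrite // e_sym.
have lower a : e w a -> a \in C -> has_nbr (C :\ w) a -> dep a < dep w.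
  move=> ewa aC /exists_inP[z]; rewrite !inE => /andP[zw zC] eaz.
  have := dep_neq ewa; rewrite neq_ltn => /orP[wa|//].
  by rewrite (leaf a ewa wa aC z zC eaz) eqxx in zw.
exists w, l; split=> // [|a b ewa ewb aC bC /lower Ha /lower Hb]; first exact: leaf.
by apply: (@parent_uniq w) => //; [apply: Ha | apply: Hb].
Qed.

(* The ideal generated by the monomials of [closed_nbhd e v :&: C], [v] in [A]:
   the ideals obtained from NI by colons and deletions are of this form. *)
Definition nbhd_ideal C A : pred {set V} :=
  fun S => [exists v in A, closed_nbhd e v :&: C \subset S].

Lemma in_closed_nbhd u v : (u \in closed_nbhd e v) = (u == v) || e v u.
Proof. by rewrite !inE. Qed.

Lemma nbhd_ideal_up C A : up_closed (nbhd_ideal C A).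
Proof.
move=> S T ST /exists_inP[v vA vS]; apply/exists_inP; exists v => //.
exact: subset_trans vS ST.
Qed.

Lemma nbhd_ideal_colon C A x : colon (nbhd_ideal C A) x =1 nbhd_ideal (C :\ x) A.
Proof.
by move=> S; apply: eq_existsb => v; rewrite setIDA subDset.
Qed.

(** The generators lost are those divisible by [x]; by symmetry of [e] they belong to the vertices
    of [closed_nbhd e x]. *)
Lemma nbhd_ideal_deletion C A x S : x \in C -> S \subset C :\ x ->
  nbhd_ideal C A S = nbhd_ideal (C :\ x) (A :\: closed_nbhd e x) S.
Proof.
move=> xC SC; have xS : x \notin S by apply: subsetD1_notin SC.
apply/exists_inP/exists_inP => -[v].
  move=> vA vS; exists v.
    rewrite inE vA andbT in_closed_nbhd eq_sym e_sym -in_closed_nbhd.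
    by apply: contra xS => xv; apply: (subsetP vS); rewrite inE xv.
  by apply: subset_trans vS; apply/setIS/subsetDl.
rewrite inE in_closed_nbhd eq_sym e_sym -in_closed_nbhd => /andP[xv vA] vS.
exists v => //; apply: subset_trans vS; apply/subsetP => u.
rewrite !in_setI !in_setD1 => /andP[uv ->]; rewrite uv andbT /=.
by apply: contraNneq xv => <-.
Qed.

(** Away from [w] the generator of [l] is the variable [l] alone, which divides the generator of
    [w]. *)
Lemma nbhd_ideal_leaf C A w l S : l \in C -> l \in A -> e w l ->
  (forall u, u \in C -> e l u -> u = w) ->
  nbhd_ideal (C :\ w) A S = nbhd_ideal (C :\ w) (A :\ w) S.
Proof.
move=> lC lA ewl leaf; apply/exists_inP/exists_inP => -[v vA vS]; last first.
  by exists v => //; move: vA; rewrite inE => /andP[].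
have [vw|vw] := eqVneq v w; last by exists v => //; rewrite !inE vw.
have lw : l != w by apply: contraTneq ewl => ->; rewrite forest_irr.
exists l; first by rewrite !inE lw.
apply: subset_trans vS; apply/subsetP => u.
rewrite vw !in_setI !in_closed_nbhd !in_setD1 => /and3P[/orP[/eqP->|elu] uw uC].
  by rewrite ewl lw lC orbT.
by rewrite (leaf u uC elu) eqxx in uw.
Qed.

(** Isolated vertices are left out: one without generator divides no generator at all and costs
    nothing. *)
Definition inactive C A : {set V} := [set v in C | (v \notin A) && has_nbr C v].

Lemma has_nbrS C C' v : C \subset C' -> has_nbr C v -> has_nbr C' v.
Proof.
by move=> CC' /exists_inP[u uC evu]; apply/exists_inP; exists u; rewrite ?(subsetP CC').
Qed.

Lemma reg_nbhd_ideal_lt C A : A \subset C ->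
  reg_lt K (nbhd_ideal C A) C (nu e C + #|inactive C A|).+1.
Proof.
have [m] := ubnP #|C|; elim: m C A => // m IH C A; rewrite ltnS => Cm AC.
have IHx x B r : x \in C -> B \subset C :\ x ->
    nu e (C :\ x) + #|inactive (C :\ x) B| < r ->
    reg_lt K (nbhd_ideal (C :\ x) B) (C :\ x) r.
  move=> xC BC le_r; apply: reg_lt_leq le_r _; apply: IH => //.
  by move: Cm; rewrite (cardsD1 x) xC.
have deletion x r : x \in C ->
    nu e (C :\ x) + #|inactive (C :\ x) (A :\: closed_nbhd e x)| < r ->
    reg_lt K (nbhd_ideal C A) (C :\ x) r.
  move=> xC le_r; apply: eq_reg_lt (IHx x _ _ xC _ le_r).
    by move=> S SC; rewrite -nbhd_ideal_deletion.
  apply/subsetP => u; rewrite !inE negb_or -andbA => /and3P[-> _ uA].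
  exact: (subsetP AC).
(* Without edges, a vertex of [A] is itself a generator and any other vertex is a free variable. *)
have [|noedge] := boolP [exists u in C, has_nbr C u]; last first.
  have iso x u : x \in C -> u \in C -> e x u = false.
    move=> xC uC; apply: contraNF noedge => exu; apply/exists_inP; exists x => //.
    by apply/exists_inP; exists u.
  have [->|[x xC]] := set_0Vmem C.
    by move=> W s i; rewrite subset0 => /eqP-> _; rewrite cards0; lia.
  have nuC := nuS e (subsetDl C [set x]).
  have inact B : inactive (C :\ x) B = set0.
    apply/setP => u; rewrite !inE; apply/negP => /and3P[/andP[_ uC] _ /exists_inP[z]].
    by rewrite !inE => /andP[_ zC]; rewrite iso.
  have [xA|xA] := boolP (x \in A).
    apply: (@reg_lt_var _ _ _ _ x); first exact: nbhd_ideal_up.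
      move=> S; apply/exists_inP; exists x => //; apply/subsetP => u.
      rewrite inE in_closed_nbhd => /andP[/orP[/eqP->|exu] uC]; first exact: setU11.
      by rewrite iso in exu.
    by apply: deletion => //; rewrite inact cards0; lia.
  apply: (@reg_lt_free _ _ _ _ x); last first.
    by apply: deletion => //; rewrite inact cards0; lia.
  move=> S SC /exists_inP[v vA vS]; apply/exists_inP; exists v => //.
  apply/subsetP => u uv; move: (subsetP vS u uv); rewrite !inE => /predU1P[ux|//].
  move: uv; rewrite inE in_closed_nbhd ux => /andP[/orP[/eqP xv|evx] _].
    by rewrite xv vA in xA.
  by rewrite iso // (subsetP AC) in evx.
move=> /forest_leaf[w [l [wC lC ewl leaf other]]].
have [lA|lA] := boolP (l \in A).
  (* [w] times [l] is a generator, so in the colon by [w] the vertex [l] becomes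
     a variable and absorbs the generator of [w]; the deletion of [w] makes at
     most one new non-isolated vertex inactive, namely the parent of [w]. *)
  have nuC := nu_geD1 e_sym forest_irr wC lC ewl leaf.
  apply: (@reg_lt_split _ _ _ _ w); first exact: nbhd_ideal_up.
    apply: (@eq_reg_lt _ _ (nbhd_ideal (C :\ w) (A :\ w))).
      by move=> S _; rewrite nbhd_ideal_colon -(nbhd_ideal_leaf _ lC lA ewl leaf).
    apply: IHx => //; first exact: setSD.
    suff : #|inactive (C :\ w) (A :\ w)| <= #|inactive C A| by lia.
    apply/subset_leq_card/subsetP => u; rewrite !inE.
    move=> /and3P[/andP[uw uC] uA /(has_nbrS (subsetDl _ _)) ->].
    by rewrite uC andbT /=; move: uA; rewrite uw.
  apply: deletion => //.
  set I := inactive _ _.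
  suff : #|I :\: inactive C A| <= 1.
    have := cardsID (inactive C A) I; have := subset_leq_card (subsetIr I (inactive C A)).
    lia.
  have new u : u \in I :\: inactive C A -> [/\ u \in C, e w u & has_nbr (C :\ w) u].
    rewrite !inE => /andP[Hu /and3P[/andP[uw uC] uA un]]; split=> //.
    move: Hu uA; rewrite uC (negPf uw) /= (has_nbrS (subsetDl _ _) un) andbT negbK => ->.
    by rewrite andbT negbK.
  by apply/card_le1_eqP => u v /new[uC ewu un] /new[vC ewv vn]; apply: other.
(* Here [l] is inactive, and splitting at [l] removes it from the count. The colon adds no inactive
   vertex; the deletion can add only [w], the sole neighbour of [l]. *)
have nuC := nuS e (subsetDl C [set l]).
have lI : l \in inactive C A.
  by rewrite inE lC lA; apply/exists_inP; exists w; rewrite // e_sym.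
have := cardsD1 l (inactive C A); rewrite lI => cI.
have sub B : inactive (C :\ l) B :\: inactive C A = set0 ->
    #|inactive (C :\ l) B| <= #|inactive C A :\ l|.
  move/eqP; rewrite setD_eq0 => BA; apply: subset_leq_card.
  by rewrite subsetD1 BA !inE eqxx.
rewrite cI addnA addn1.
apply: (@reg_lt_split _ _ _ _ l); first exact: nbhd_ideal_up.
  apply: (@eq_reg_lt _ _ (nbhd_ideal (C :\ l) A)).
    by move=> S _; rewrite nbhd_ideal_colon.
  apply: IHx => //; first by rewrite subsetD1 AC.
  suff : #|inactive (C :\ l) A| <= #|inactive C A :\ l| by lia.
  apply: subset_leq_card; apply/subsetP => u; rewrite !inE.
  by move=> /and3P[/andP[-> ->] -> /(has_nbrS (subsetDl _ _)) ->].
apply: deletion => //.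
suff : #|inactive (C :\ l) (A :\: closed_nbhd e l)| <= #|w |: (inactive C A :\ l)|.
  rewrite cardsU1; lia.
apply: subset_leq_card; apply/subsetP => u; rewrite !inE negb_and negbK.
move=> /and3P[/andP[ul uC] uA un].
rewrite (negPf ul) uC (has_nbrS (subsetDl _ _) un) /= in uA *.
by case/orP: uA => [/(leaf u uC)->|->]; rewrite ?eqxx ?orbT.
Qed.

(* Induction on the forest: the deletion of [w] is a cone over the leaf [l], so
   the homology of the link of [w] embeds in that of the whole complex. *)
Lemma nbhd_ideal_not_exact C : exists2 i, i + nu e C = #|C| &
  forall s : {set V} -> V -> K, koszul_sign s C ->
    ~ exact_at s C (coface (nbhd_ideal C C) C) i.
Proof.
have [m] := ubnP #|C|; elim: m C => // m IH C; rewrite ltnS => Cm.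
have [|noedge] := boolP [exists u in C, has_nbr C u]; last first.
  have nu0 : nu e C = 0.
    have [M /matching_inP[H1 _ H3] <-] := nu_ex e C.
    apply/eqP; rewrite cards_eq0; apply: contraNT noedge => /set0Pn[E EM].
    have [u [v [_ euv defE]]] := H1 _ EM; have /subsetP EC := H3 _ EM.
    apply/exists_inP; exists u; first by apply: EC; rewrite defE set21.
    by apply/exists_inP; exists v; first by apply: EC; rewrite defE set22.
  exists #|C| => [|s sP ex]; first by rewrite nu0 addn0.
  (* The ideal is generated by all variables of [C], so [C] is the only coface. The constant chain 1
     is vacuously a cycle, while every boundary vanishes at [C]. *)
  have [|c' c'P] := ex (fun=> 1%R).
    move=> G GC NG cG; case/negP: NG; have /cards1P[v vE] : #|C :\: G| == 1.
      by rewrite cardsD (setIidPr GC); lia.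
    have : v \in C :\: G by rewrite vE inE.
    rewrite inE => /andP[vG vC]; apply/exists_inP; exists v => //.
    apply/subsetP => u; rewrite inE in_closed_nbhd vE inE => /andP[/orP[//|evu] uC].
    case/negP: noedge; apply/exists_inP; exists v => //.
    by apply/exists_inP; exists u.
  have : coface (nbhd_ideal C C) C C.
    rewrite /coface setDv; apply/exists_inP => -[v vC /subsetP/(_ v)].
    by rewrite in_setI in_closed_nbhd eqxx vC !inE => /(_ isT).
  move/(c'P C (subxx _))/(_ erefl); rewrite /koszul_bd setDv big_set0 => /esym/eqP.
  exact/negP/oner_neq0.
move=> /forest_leaf[w [l [wC lC ewl leaf _]]].
have lw : l != w by apply: contraTneq ewl => ->; rewrite forest_irr.
have nuC : nu e C = (nu e (C :\ w)).+1.
  apply/eqP; rewrite eqn_leq nu_leD1 /=; exact: (nu_geD1 e_sym forest_irr wC lC ewl leaf).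
have cC := cardsD1 w C; rewrite wC in cC.
have [|i iC nex] := IH (C :\ w); first by lia.
(* The degree [i] is kept, since [#|C|] and the matching number both drop by one. *)
exists i => [|s sP ex]; first by lia.
apply: (nex s (koszul_signD1 w sP)).
apply: (@eq_exact_at _ _ _ _ (coface (nbhd_ideal C C) C)).
  move=> G GC; rewrite (coface_link _ wC (subsetD1_notin GC)).
  by congr (~~ _); rewrite nbhd_ideal_colon (nbhd_ideal_leaf _ lC lC ewl leaf).
apply: (exact_at_link sP wC) ex.
  by move=> G _; apply: (coface_up (@nbhd_ideal_up _ _)); apply: subsetUr.
apply: (@eq_exact_at _ _ _ _ (coface (nbhd_ideal C C) (C :\ w))).
  by move=> G _; rewrite coface_deletion.
have lCw : l \in C :\ w by rewrite !inE lw.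
apply: (exact_at_cone (shift_koszul_sign wC sP) lCw) => G GC.
rewrite coface_deletion (coface_link _ lCw (subsetD1_notin GC)).
apply: contra => /exists_inP[v vC vS]; apply/exists_inP; exists v => //.
apply/subsetP => u uv; have := subsetP vS u uv; case/setU1P=> [ul|//].
(* A generator divisible by [l] comes from [l] or [w], hence is divisible by the deleted [w]; this
   is why the deletion is a cone over [l]. *)
have : w \in l |: ((C :\ w :\ l) :\: G).
  apply: (subsetP vS); rewrite inE wC andbT in_closed_nbhd.
  move: uv; rewrite ul inE in_closed_nbhd => /andP[/orP[/eqP<-|evl] _].
    by rewrite e_sym ewl orbT.
  by rewrite (leaf v vC) ?eqxx // e_sym.
by rewrite !inE eqxx eq_sym (negPf lw) !andbF.
Qed.

Lemma strandE (b : {ffun V -> nat}) (F : {set V}) :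
  (forall u, b u <= 1) -> F \subset bsupp b ->
  strand e b F = coface (nbhd_ideal setT setT) (bsupp b) F.
Proof.
move=> b1 Fb; congr (~~ _); apply/existsP/exists_inP => -[v].
  move=> /forall_inP H; exists v => //; apply/subsetP => u; rewrite setIT => /H.
  by rewrite !inE ffunE; have := b1 u; lia.
move=> _ /subsetP H; exists v; apply/forall_inP => u uv.
have := H u; rewrite setIT uv => /(_ isT); rewrite !inE ffunE.
by case: (u \in F) => //=; rewrite subn0.
Qed.

Theorem forest_reg : is_reg e K (matching_number e).
Proof.
split=> [i b|].
  apply: contraNleq => bi; apply/eqP/betti_exact.
  (* If [b x] exceeds 1, then [x] still divides the monomial after one factor is removed, so
     membership in the strand ignores [x]. *)
  have [/existsP[x bx]|b1] := boolP [exists x, 1 < b x].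
    have xb : x \in bsupp b by rewrite inE; lia.
    apply: (exact_at_cone (koszul_rank_sign _ _) xb) => G GW.
    apply: contra => /existsP[v /forall_inP H]; apply/existsP; exists v.
    apply/forall_inP => u /H; rewrite !ffunE !inE.
    by case: eqP => [->|] //=; have := subsetD1_notin GW; lia.
  have {}b1 u : b u <= 1.
    by rewrite leqNgt; apply: contra b1 => bu; apply/existsP; exists u.
  have Eb : #|bsupp b| = \sum_u b u.
    rewrite -sum1_card big_mkcond; apply: eq_bigr => u _.
    by rewrite inE; have := b1 u; case: (b u) => [|[]].
  apply: (@eq_exact_at _ _ _ _ (coface (nbhd_ideal setT setT) (bsupp b))).
    by move=> G GW; rewrite strandE.
  apply: reg_nbhd_ideal_lt; rewrite ?subsetT //; first exact: koszul_rank_sign.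
  have -> : inactive setT setT = set0 by apply/setP => u; rewrite !inE.
  by rewrite cards0 addn0 nu_setT Eb addnS.
have [i iC nex] := nbhd_ideal_not_exact setT.
pose b : {ffun V -> nat} := [ffun=> 1].
have bT : bsupp b = setT by apply/setP => u; rewrite !inE ffunE.
exists i, b; split; last first.
  rewrite -nu_setT iC cardsT -sum1_card; apply: eq_bigr => u _; by rewrite ffunE.
apply/eqP => /betti_exact; rewrite bT => ex.
apply: (nex _ (koszul_rank_sign _ _)); apply: eq_exact_at ex => G GT.
by rewrite strandE ?bT // => u; rewrite ffunE.
Qed.

End Forest.

(** * Generalized stars as forests *)

Lemma star_adj_sym (k : nat) (n : 'I_k -> nat) : symmetric (star_adj n).
Proof.
by case=> [s|] [t|] //; rewrite /star_adj eq_sym orbC.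
Qed.

(** The distance to the centre, which roots the star there: each other vertex has exactly one
    neighbour closer to it. *)
Definition star_depth (k : nat) (n : 'I_k -> nat) (v : star_vertex n) : nat :=
  if v is Some t then (tagged t).+1 else 0.

Theorem theorem2p8 (K : fieldType) (k : nat) (n : 'I_k -> nat) :
  (0 < k)%N -> (forall i, (2 <= n i)%N) ->
  is_reg (star_adj n) K (matching_number (star_adj n)).
Proof.
move=> _ _; apply: (@forest_reg _ _ K (@star_depth k n)).
- exact: star_adj_sym.
- case=> [s|] [t|] //; rewrite /star_adj /star_depth /=.
  by case/andP => _; case/orP => /eqP; lia.
case=> [[i p]|] [[j q]|] [[j' q']|] //; rewrite /star_adj /star_depth /=; try by lia.
case/andP=> /eqP ij; subst j; move=> Hq /andP[/eqP ij]; subst j' => Hq' lq lq'.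
by congr (Some (Tagged _ _)); apply: val_inj; rewrite /=; lia.
Qed.
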